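(* Let $\mathcal{A}$ be a coquasitriangular Hopf algebra with universal $r$-form $\mathbf{r}$, let $v=(v^k_l)_{k,l=1,\dots,n}$ be a matrix corepresentation of $\mathcal{A}$ and let $\zeta$ be a central character of $\mathcal{A}$. Let $\Gamma_{v,\zeta}$ be the associated bicovariant first order differential calculus over $\mathcal{A}$ and let $C_{v,\zeta}\in\mathcal{A}^\circ$ be the associated functional (both defined in the context), regarded as the element $b\mapsto C_{v,\zeta}\triangleright b$ of $L(\mathcal{A})$. Let $\rho:\mathcal{A}\to L(\mathcal{A})$ be the algebra homomorphism $\rho(a)b=ab$. Then the pair $(\rho,C_{v,\zeta})$ is an algebraic commutator representation of $\Gamma_{v,\zeta}$ with $\mathcal{B}=L(\mathcal{A})$.
   Context: All algebras are unital and over $\mathbb{C}$; algebra homomorphisms preserve units. $L(V)$ is the algebra of linear mappings of a vector space $V$ into itself. A first order differential calculus (FODC) over $\mathcal{A}$ is an $\mathcal{A}$-bimodule $\Gamma$ with a linear mapping $d:\mathcal{A}\to\Gamma$ such that $d(ab)=a\,db+da\,b$ and $\Gamma=\mathrm{Lin}\{a\,db:\ a,b\in\mathcal{A}\}$. Algebraic commutator representation: for an algebra homomorphism $\rho:\mathcal{A}\to\mathcal{B}$ into an algebra $\mathcal{B}$ and $C\in\mathcal{B}$, the pair $(\rho,C)$ is an algebraic commutator representation of a FODC $\Gamma$ over $\mathcal{A}$ if there is a (well-defined) linear mapping $\tau:\Gamma\to\mathcal{B}$ with $\tau(a\,db)=i\rho(a)(C\rho(b)-\rho(b)C)$ for all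 $a,b\in\mathcal{A}$. Universal $r$-form: a convolution invertible linear functional $\mathbf{r}$ on $\mathcal{A}\otimes\mathcal{A}$ with $\mathbf{r}(ab\otimes c)=\mathbf{r}(a\otimes c_{(1)})\mathbf{r}(b\otimes c_{(2)})$, $\mathbf{r}(a\otimes bc)=\mathbf{r}(a_{(1)}\otimes c)\mathbf{r}(a_{(2)}\otimes b)$ and $\mathbf{r}(a_{(1)}\otimes b_{(1)})a_{(2)}b_{(2)}=b_{(1)}a_{(1)}\mathbf{r}(a_{(2)}\otimes b_{(2)})$; $\bar{\mathbf{r}}$ is its convolution inverse. $\mathcal{A}^\circ$ is the dual Hopf algebra of $\mathcal{A}$ with product $(fg)(a)=f(a_{(1)})g(a_{(2)})$ and unit $\varepsilon$; $f\triangleright a=a_{(1)}\langle f,a_{(2)}\rangle$ for $f\in\mathcal{A}^\circ,a\in\mathcal{A}$. A matrix corepresentation is a matrix $v=(v^k_l)\in M_n(\mathcal{A})$ with $\Delta(v^k_l)=\sum_j v^k_j\otimes v^j_l$, $\varepsilon(v^k_l)=\delta_{kl}$. A central character is an algebra homomorphism $\zeta:\mathcal{A}\to\mathbb{C}$ which is central for the convolution product, i.e. $\zeta(a_{(1)})a_{(2)}=a_{(1)}\zeta(a_{(2)})$ for $a\in\mathcal{A}$. Define elements of $\mathcal{A}^\circ$ by $l^{+k}_j(\cdot)=\mathbf{r}(\cdot\otimes v^k_j)$, $l^{-k}_j(\cdot)=\bar{\mathbf{r}}(v^k_j\otimes\cdot)$, $l^k_j=\sum_t S(l^{-k}_t)\,l^{+t}_j$,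 $f^{kj}_{st}=\zeta\, S(l^{-s}_k)\,l^{+j}_t$. Let $\tilde\Gamma_{v,\zeta}$ be the $\mathcal{A}$-bimodule which is the free left $\mathcal{A}$-module with basis $\theta_{kj}$, $k,j=1,\dots,n$, and right action determined by $\theta_{kj}a=\sum_{s,t}(f^{kj}_{st}\triangleright a)\theta_{st}$. Put $\theta=\sum_k\theta_{kk}$, $da=\theta a-a\theta$ for $a\in\mathcal{A}$, and $\Gamma_{v,\zeta}=\mathcal{A}\cdot d\mathcal{A}\cdot\mathcal{A}\subseteq\tilde\Gamma_{v,\zeta}$. Then $(\Gamma_{v,\zeta},d)$ is a bicovariant FODC over $\mathcal{A}$. Finally put $X_{kj}=\zeta l^k_j-\delta_{kj}\varepsilon$, $A^j_k=\sum_s\mathbf{r}(S^2(v^j_s)\otimes v^s_k)\in\mathbb{C}$ and $C_{v,\zeta}=\sum_{k,j}A^j_k X_{kj}\in\mathcal{A}^\circ$. *)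

(* Defs.v *)
From HB Require Import structures.
From mathcomp Require Import all_boot all_order all_algebra.
From mathcomp Require Import boolp reals.
From mathcomp Require Import complex.
Set Implicit Arguments.
Unset Strict Implicit.
Unset Printing Implicit Defensive.
Import GRing.Theory.
Local Open Scope ring_scope.
Local Open Scope quotient_scope.

(* Vector spaces and algebras are lmodType K and algType K;    *)
(* the ground field is specialized to R[i], R : realType, only at the end.     *)

Section TensorProduct.
Variables (K : fieldType) (V W : lmodType K).

(* Congruence on formal sums  v1 (x) w1 + ... + vm (x) wm,  represented by   *)
(* lists of pairs, whose quotient is the tensor product of V and W.           *)
Inductive tens_eq : seq (V * W) -> seq (V * W) -> Prop :=
| TensRefl s : tens_eq s s
| TensSym s t : tens_eq s t -> tens_eq t s
| TensTrans s t u : tens_eq s t -> tens_eq t u -> tens_eq s u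
| TensCat s s' t t' : tens_eq s s' -> tens_eq t t' -> tens_eq (s ++ t) (s' ++ t')
| TensComm s t : tens_eq (s ++ t) (t ++ s)
| TensZero w : tens_eq [:: (0, w)] [::]
| TensDl v v' w : tens_eq [:: (v + v', w)] [:: (v, w); (v', w)]
| TensDr v w w' : tens_eq [:: (v, w + w')] [:: (v, w); (v, w')]
| TensZ (c : K) v w : tens_eq [:: (c *: v, w)] [:: (v, c *: w)].

Definition tens_eqb (s t : seq (V * W)) : bool := `[< tens_eq s t >].

Lemma tens_eqb_equiv : equiv_class_of tens_eqb.
Proof.
split=> [s|s t|t s u].
- exact/asboolP/TensRefl.
- by apply/asboolP/asboolP => /TensSym.
- by move=> /asboolP st /asboolP tu; apply/asboolP/(TensTrans st tu).
Qed.

Canonical tens_eqb_rel := EquivRelPack tens_eqb_equiv.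

Definition tensor := {eq_quot tens_eqb}.
HB.instance Definition _ := Choice.on tensor.

(* The class of a formal sum, and a formal sum representing a tensor. *)
Definition tens_sum (s : seq (V * W)) : tensor := \pi_tensor s.
Definition tens_rep (t : tensor) : seq (V * W) := repr t.

Lemma tens_repK : cancel tens_rep tens_sum.
Proof. by move=> t; rewrite /tens_sum reprK. Qed.

Lemma tensP (s t : seq (V * W)) :
  tens_sum s = tens_sum t <-> tens_eq s t.
Proof. by split=> [/eqmodP/asboolP | st]; last exact/eqmodP/asboolP. Qed.

Lemma tensW (P : tensor -> Prop) :
  (forall s, P (tens_sum s)) -> forall t, P t.
Proof. by move=> Ps t; rewrite -[t]tens_repK. Qed.

Lemma tens_sum_rep (s : seq (V * W)) : tens_eq (tens_rep (tens_sum s)) s.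
Proof. by apply/tensP; rewrite tens_repK. Qed.

Definition tens_scale (c : K) (t : tensor) : tensor :=
  tens_sum [seq (c *: p.1, p.2) | p <- tens_rep t].
Definition tens_add (t u : tensor) : tensor := tens_sum (tens_rep t ++ tens_rep u).

Lemma tens_eqZ c (s t : seq (V * W)) : tens_eq s t ->
  tens_eq [seq (c *: p.1, p.2) | p <- s] [seq (c *: p.1, p.2) | p <- t].
Proof.
elim=> {s t} [s|s t _|s t u _ st _|s s' t t' _ ss _ tt|s t|w|v v' w|v w w'|b v w] /=.
- exact: TensRefl.
- exact: TensSym.
- exact: TensTrans.
- by rewrite !map_cat; apply: TensCat.
- by rewrite !map_cat; apply: TensComm.
- by rewrite scaler0; apply: TensZero.
- by rewrite scalerDr; apply: TensDl.
- exact: TensDr.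
- by rewrite scalerA mulrC -scalerA; apply: TensZ.
Qed.

Lemma tens_addE s t :
  tens_add (tens_sum s) (tens_sum t) = tens_sum (s ++ t).
Proof. by apply/tensP/TensCat; apply: tens_sum_rep. Qed.

Lemma tens_scaleE c s :
  tens_scale c (tens_sum s) = tens_sum [seq (c *: p.1, p.2) | p <- s].
Proof. by apply/tensP/tens_eqZ/tens_sum_rep. Qed.

Lemma tens_addA : associative tens_add.
Proof.
move=> s t u; elim/tensW: s => s; elim/tensW: t => t; elim/tensW: u => u.
by rewrite !tens_addE catA.
Qed.

Lemma tens_addC : commutative tens_add.
Proof.
move=> s t; elim/tensW: s => s; elim/tensW: t => t.
by rewrite !tens_addE; apply/tensP/TensComm.
Qed.

Lemma tens_add0 : left_id (tens_sum [::]) tens_add.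
Proof. by move=> s; elim/tensW: s => s; rewrite tens_addE. Qed.

HB.instance Definition _ :=
  GRing.isNmodule.Build tensor tens_addA tens_addC tens_add0.

Lemma pi_cat (s t : seq (V * W)) :
  tens_sum (s ++ t) = tens_sum s + tens_sum t :> tensor.
Proof. by rewrite [RHS]tens_addE. Qed.

Lemma pi_cons p (s : seq (V * W)) :
  tens_sum (p :: s) = tens_sum [:: p] + tens_sum s :> tensor.
Proof. by rewrite -cat1s pi_cat. Qed.

Lemma tens_scaleA a b t : tens_scale a (tens_scale b t) = tens_scale (a * b) t.
Proof.
elim/tensW: t => s; rewrite !tens_scaleE -map_comp; congr tens_sum.
by apply: eq_map => p /=; rewrite scalerA.
Qed.

Lemma tens_scale0 t : tens_scale 0 t = 0.
Proof.
elim/tensW: t => s; rewrite tens_scaleE; elim: s => [//|p s IHs] /=.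
rewrite pi_cons IHs addr0 scale0r; apply/tensP/TensZero.
Qed.

Lemma tens_scale1 : left_id 1 tens_scale.
Proof.
move=> s; elim/tensW: s => s; rewrite tens_scaleE; congr tens_sum.
by rewrite -[RHS]map_id; apply: eq_map => -[v w] /=; rewrite scale1r.
Qed.

Lemma tens_scaleDr : right_distributive tens_scale +%R.
Proof.
move=> c s t; elim/tensW: s => s; elim/tensW: t => t.
by rewrite -pi_cat !tens_scaleE map_cat pi_cat.
Qed.

Lemma tens_scaleDl t : {morph tens_scale^~ t : a b / a + b}.
Proof.
move=> a b; elim/tensW: t => s; rewrite !tens_scaleE.
elim: s => [|p s IHs] /=; first by rewrite add0r.
rewrite pi_cons (pi_cons (a *: _, _)) (pi_cons (b *: _, _)) IHs addrACA; congr (_ + _).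
by rewrite -pi_cat scalerDl; apply/tensP/TensDl.
Qed.

HB.instance Definition _ := GRing.Nmodule_isLSemiModule.Build K tensor
  tens_scaleA tens_scale0 tens_scale1 tens_scaleDr tens_scaleDl.
HB.instance Definition _ := GRing.LSemiModule_isLmodule.Build K tensor.

Definition tens (v : V) (w : W) : tensor := tens_sum [:: (v, w)].

End TensorProduct.
Section TensorLift.
Variables (K : fieldType) (V W U : lmodType K).

Definition bilin (F : V -> W -> U) : Prop :=
  (forall w (a : K) v v', F (a *: v + v') w = a *: F v w + F v' w) /\
  (forall v (a : K) w w', F v (a *: w + w') = a *: F v w + F v w').

(* The linear map on the tensor product induced by a bilinear F; the value   *)
(* does not depend on the representative (see tlift_tens and tlift_linear).   *)
Definition tlift (F : V -> W -> U) (t : tensor V W) : U :=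
  \sum_(p <- tens_rep t) F p.1 p.2.

Lemma tens_eq_lift (F : V -> W -> U) s t : bilin F -> tens_eq s t ->
  \sum_(p <- s) F p.1 p.2 = \sum_(p <- t) F p.1 p.2.
Proof.
move=> [Fl Fr]; elim=> {s t} [//|s t _ ->//|s t u _ -> _ ->//|
    s s' t t' _ ss _ tt|s t|w|v v' w|v w w'|b v w];
  rewrite ?big_cat /= ?big_cons ?big_nil ?addr0 /=.
- by rewrite ss tt.
- by rewrite addrC.
- by have := Fl w (-1) 0 0; rewrite scaleN1r addr0 oppr0 scaleN1r addNr.
- by have := Fl w 1 v v'; rewrite !scale1r.
- by have := Fr v 1 w w'; rewrite !scale1r.
- have F0l : F 0 w = 0.
    by have := Fl w (-1) 0 0; rewrite scaleN1r addr0 oppr0 scaleN1r addNr.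
  have F0r : F v 0 = 0.
    by have := Fr v (-1) 0 0; rewrite scaleN1r addr0 oppr0 scaleN1r addNr.
  by have := Fl w b v 0; have := Fr v b w 0; rewrite !addr0 F0l F0r !addr0 => -> ->.
Qed.

Lemma tlift_sum (F : V -> W -> U) s : bilin F ->
  tlift F (tens_sum s) = \sum_(p <- s) F p.1 p.2.
Proof. by move=> Fb; apply: tens_eq_lift (tens_sum_rep s). Qed.

Lemma tlift_tens (F : V -> W -> U) v w : bilin F -> tlift F (tens v w) = F v w.
Proof. by move=> Fb; rewrite tlift_sum // big_seq1. Qed.

Lemma tlift_linear (F : V -> W -> U) : bilin F -> linear (tlift F).
Proof.
move=> Fb a s t; elim/tensW: s => s; elim/tensW: t => t.
have -> : a *: tens_sum s + tens_sum t =
    tens_sum ([seq (a *: p.1, p.2) | p <- s] ++ t).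
  by rewrite pi_cat -[in RHS]tens_scaleE.
rewrite !tlift_sum // big_cat /= big_map scaler_sumr; congr (_ + _).
apply: eq_bigr => -[v w] _ /=.
case: Fb => Fl _; have F0 : F 0 w = 0.
  by have := Fl w (-1) 0 0; rewrite scaleN1r addr0 oppr0 scaleN1r addNr.
by have := Fl w a v 0; rewrite !addr0 F0 addr0.
Qed.

End TensorLift.

Section TensLinear.
Variables (K : fieldType) (V W : lmodType K).

Lemma tens_bilin : bilin (@tens K V W).
Proof.
have tZ a v w : a *: tens v w = tens (a *: v : V) (w : W).
  exact: (tens_scaleE a [:: (v, w)]).
split=> [w a v v'|v a w w']; rewrite tZ /tens -pi_cons; apply/tensP.
  exact: TensDl.
apply: TensTrans (TensDr _ _ _) _; rewrite -cat1s -[X in tens_eq _ X]cat1s.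
by apply: TensCat (TensRefl _); apply/TensSym/TensZ.
Qed.

Definition tensl (w : W) (v : V) : tensor V W := tens v w.
Fact tensl_linear w : linear (tensl w).
Proof. by move=> a v v'; apply: tens_bilin.1. Qed.
HB.instance Definition _ w := GRing.isLinear.Build K V (tensor V W) *:%R
  (tensl w) (tensl_linear w).
Fact tens_linear v : linear (@tens K V W v).
Proof. by move=> a w w'; apply: tens_bilin.2. Qed.
HB.instance Definition _ v := GRing.isLinear.Build K W (tensor V W) *:%R
  (tens v) (tens_linear v).
End TensLinear.

(* Sweedler sums a_(1) (x) a_(2) are written tlift F (comul a), the value at  *)
(* comul a of the linear map induced by the bilinear map F. In coassoc,        *)
(* A (x) A (x) A is taken as A (x) (A (x) A).                                  *)
#[key="A"]
HB.mixin Record isHopf (K : fieldType) A of GRing.Algebra K A := {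
  comul : {linear A -> tensor A A};
  counit : {lrmorphism A -> K^o};
  antipode : {linear A -> A};
  coassoc : forall a,
    tlift (fun x y => tlift (fun x1 x2 => tens x1 (tens x2 y)) (comul x))
          (comul a)
    = tlift (fun x y => tens x (comul y)) (comul a);
  counitl : forall a, tlift (fun x y => counit x *: y) (comul a) = a;
  counitr : forall a, tlift (fun x y => counit y *: x) (comul a) = a;
  comul1 : comul 1 = tens 1 1;
  comulM : forall a b, comul (a * b) =
    tlift (fun a1 a2 => tlift (fun b1 b2 => tens (a1 * b1) (a2 * b2)) (comul b))
          (comul a);
  antipodel : forall a, tlift (fun x y => antipode x * y) (comul a) = (counit a)%:A;
  antipoder : forall a, tlift (fun x y => x * antipode y) (comul a) = (counit a)%:A
}.
#[short(type="hopfAlgType")]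
HB.structure Definition Hopf (K : fieldType) := {A of GRing.Algebra K A & isHopf K A}.

Section LinearMaps.
Variables (K : fieldType) (U V : lmodType K).
Implicit Types f g h : {linear U -> V}.
HB.instance Definition _ := gen_eqMixin {linear U -> V}.
HB.instance Definition _ := gen_choiceMixin {linear U -> V}.

Lemma linmap_eq f g : f =1 g -> f = g.
Proof.
case: f g => [f [[fD] [fZ]]] [g [[gD] [gZ]]] /= /funext efg; subst g.
by rewrite (Prop_irrelevance fD gD) (Prop_irrelevance fZ gZ).
Qed.

Definition linmap (f : U -> V) (fl : linear f) : {linear U -> V} :=
  HB.pack f (GRing.isLinear.Build K U V *:%R f fl).

Fact lin_add_subproof f g : linear (fun x => f x + g x).
Proof. by move=> a x y; rewrite !linearP scalerDr addrACA. Qed.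
Fact lin_scale_subproof (a : K) f : linear (fun x => a *: f x).
Proof. by move=> b x y; rewrite linearP scalerDr !scalerA mulrC. Qed.
Fact lin_zero_subproof : linear (fun _ : U => 0 : V).
Proof. by move=> b x y; rewrite scaler0 addr0. Qed.
Definition lin_add f g := linmap (lin_add_subproof f g).
Definition lin_scale a f := linmap (lin_scale_subproof a f).
Definition lin_zero := linmap lin_zero_subproof.

Fact lin_addA : associative lin_add.
Proof. by move=> f g h; apply: linmap_eq => x /=; rewrite addrA. Qed.
Fact lin_addC : commutative lin_add.
Proof. by move=> f g; apply: linmap_eq => x /=; rewrite addrC. Qed.
Fact lin_add0 : left_id lin_zero lin_add.
Proof. by move=> f; apply: linmap_eq => x /=; rewrite add0r. Qed.
HB.instance Definition _ := GRing.isNmodule.Build {linear U -> V}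
  lin_addA lin_addC lin_add0.
Fact lin_scaleA a b f : lin_scale a (lin_scale b f) = lin_scale (a * b) f.
Proof. by apply: linmap_eq => x /=; rewrite scalerA. Qed.
Fact lin_scale0 f : lin_scale 0 f = 0.
Proof. by apply: linmap_eq => x /=; rewrite scale0r. Qed.
Fact lin_scale1 : left_id 1 lin_scale.
Proof. by move=> f; apply: linmap_eq => x /=; rewrite scale1r. Qed.
Fact lin_scaleDr : right_distributive lin_scale +%R.
Proof. by move=> a f g; apply: linmap_eq => x /=; rewrite scalerDr. Qed.
Fact lin_scaleDl f : {morph lin_scale^~ f : a b / a + b}.
Proof. by move=> a b; apply: linmap_eq => x /=; rewrite scalerDl. Qed.
HB.instance Definition _ := GRing.Nmodule_isLSemiModule.Build K {linear U -> V}
  lin_scaleA lin_scale0 lin_scale1 lin_scaleDr lin_scaleDl.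
HB.instance Definition _ := GRing.LSemiModule_isLmodule.Build K {linear U -> V}.

Lemma lin_addE f g x : (f + g) x = f x + g x. Proof. by []. Qed.
Lemma lin_scaleE a f x : (a *: f) x = a *: f x. Proof. by []. Qed.
Lemma lin_zeroE x : (0 : {linear U -> V}) x = 0. Proof. by []. Qed.
Lemma lin_oppE f x : (- f) x = - f x.
Proof. by rewrite -scaleN1r lin_scaleE scaleN1r. Qed.
Lemma lin_sumE I r (P : pred I) (F : I -> {linear U -> V}) x :
  (\sum_(i <- r | P i) F i) x = \sum_(i <- r | P i) F i x.
Proof. by elim/big_rec2: _ => // i y f _ <-. Qed.
End LinearMaps.

(* The algebra L(V) of linear maps of V into itself, with composition. *)
Definition endo (K : fieldType) (V : lmodType K) : Type := {linear V -> V}.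

Section Endo.
Variable K : fieldType.
HB.instance Definition _ (V : lmodType K) := GRing.Lmodule.on (endo V).

Section Ring.
Variable V : lmodType K.
Definition endo_mul (f g : endo V) : endo V := f \o g.
Definition endo_one : endo V := idfun.
Fact endo_mulA : associative endo_mul.
Proof. by move=> f g h; apply: linmap_eq. Qed.
Fact endo_mul1 : left_id endo_one endo_mul.
Proof. by move=> f; apply: linmap_eq. Qed.
Fact endo_1mul : right_id endo_one endo_mul.
Proof. by move=> f; apply: linmap_eq. Qed.
Fact endo_mulDl : left_distributive endo_mul +%R.
Proof. by move=> f g h; apply: linmap_eq. Qed.
Fact endo_mulDr : right_distributive endo_mul +%R.
Proof. by move=> f g h; apply: linmap_eq => x /=; rewrite linearD. Qed.
HB.instance Definition _ := GRing.Zmodule_isPzRing.Build (endo V)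
  endo_mulA endo_mul1 endo_1mul endo_mulDl endo_mulDr.
End Ring.

Section Algebra.
Variable A : algType K.
Fact endo_oner_neq0 : 1 != 0 :> endo A.
Proof.
by apply/eqP => /(congr1 (fun f : {linear A -> A} => f 1)) /eqP; apply/negP/oner_neq0.
Qed.
HB.instance Definition _ := GRing.PzSemiRing_isNonZero.Build (endo A) endo_oner_neq0.
Fact endo_scaleAl (a : K) (f g : endo A) : a *: (f * g) = (a *: f) * g.
Proof. exact: linmap_eq. Qed.
HB.instance Definition _ := GRing.Lmodule_isLalgebra.Build K (endo A) endo_scaleAl.
Fact endo_scaleAr (a : K) (f g : endo A) : a *: (f * g) = f * (a *: g).
Proof. by apply: linmap_eq => x /=; rewrite linearZ. Qed.
HB.instance Definition _ := GRing.Lalgebra_isAlgebra.Build K (endo A) endo_scaleAr.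

Fact lmul_linear_subproof (a : A) : linear (fun b => a * b).
Proof. by move=> c x y; rewrite mulrDr scalerAr. Qed.
(* The left multiplication representation, lmul a b = a * b. *)
Definition lmul (a : A) : endo A := linmap (lmul_linear_subproof a).
Fact lmul_linear : linear lmul.
Proof. by move=> c x y; apply: linmap_eq => b /=; rewrite mulrDl scalerAl. Qed.
HB.instance Definition _ := GRing.isLinear.Build K A (endo A) *:%R lmul lmul_linear.
Fact lmul_monoid_morphism : monoid_morphism lmul.
Proof.
by split=> [|x y]; apply: linmap_eq => b /=; rewrite ?mul1r ?mulrA.
Qed.
HB.instance Definition _ := GRing.isMonoidMorphism.Build A (endo A) lmul lmul_monoid_morphism.
End Algebra.
End Endo.

Notation "'\sw_' ( x , y <- a ) E" := (tlift (fun x y => E) (comul a))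
  (at level 36, x binder, y binder, a at level 10, E at level 36,
   format "'\sw_' ( x ,  y  <-  a )  E") : ring_scope.

Section Sweedler.
Variables (K : fieldType) (A : hopfAlgType K).

Lemma tlift_morph (V W U U' : lmodType K) (g : {linear U -> U'})
    (F : V -> W -> U) t : g (tlift F t) = tlift (fun x y => g (F x y)) t.
Proof. by rewrite /tlift linear_sum. Qed.

Lemma tlift_lin (V W U : lmodType K) (F : V -> W -> U) a s t : bilin F ->
  tlift F (a *: s + t) = a *: tlift F s + tlift F t.
Proof. by move=> Fb; rewrite tlift_linear. Qed.

Lemma eq_tlift (V W U : lmodType K) (F G : V -> W -> U) t :
  (forall x y, F x y = G x y) -> tlift F t = tlift G t.
Proof. by move=> eFG; apply: eq_bigr => p _; apply: eFG. Qed.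

Lemma tliftP (V W U : lmodType K) (F G : V -> W -> U) (c : K) t :
  tlift (fun x y => c *: F x y + G x y) t = c *: tlift F t + tlift G t.
Proof. by rewrite /tlift big_split scaler_sumr. Qed.

Lemma tlift_exch (V W V' W' U : lmodType K) (F : V -> W -> V' -> W' -> U) t t' :
  tlift (fun x y => tlift (fun x' y' => F x y x' y') t') t
  = tlift (fun x' y' => tlift (fun x y => F x y x' y') t) t'.
Proof. exact: exchange_big. Qed.

Definition trilin (U : lmodType K) (G : A -> A -> A -> U) :=
  (forall x, bilin (G x)) /\ (forall z, bilin (fun x y => G x y z)).

Lemma tlift_bilin (V W V' W' U : lmodType K) (F : V' -> W' -> V -> W -> U) t :
  (forall x y, bilin (fun x' y' => F x' y' x y)) ->
  bilin (fun x' y' => tlift (F x' y') t).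
Proof.
move=> Fb; split=> [w a v v'|v a w w']; rewrite -tliftP; apply: eq_tlift => x y.
  by case: (Fb x y) => + _; apply.
by case: (Fb x y) => _; apply.
Qed.

Lemma sw_coassoc (U : lmodType K) (G : A -> A -> A -> U) a : trilin G ->
  \sw_(x, y <- a) \sw_(x1, x2 <- x) G x1 x2 y
  = \sw_(x, y <- a) \sw_(y1, y2 <- y) G x y1 y2.
Proof.
move=> [Gr Gl].
have Tb : bilin (fun x u => tlift (G x) u).
  split=> [u c x x'|x c u u']; last exact: tlift_lin.
  by rewrite -tliftP; apply: eq_tlift => y z; case: (Gl z) => + _; apply.
have TE := tlift_linear Tb.
have := congr1 (linmap TE) (coassoc a).
rewrite !tlift_morph /= => e; transitivity (tlift (fun x y =>
  tlift (fun x1 x2 => tlift (fun x u => tlift (G x) u) (tens x1 (tens x2 y)))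
    (comul x)) (comul a)).
  apply: eq_tlift => x y; apply: eq_tlift => x1 x2.
  by rewrite !tlift_tens.
transitivity (tlift (fun x y =>
  linmap TE (tlift (fun x1 x2 => tens x1 (tens x2 y)) (comul x))) (comul a)).
  by apply: eq_tlift => x y; rewrite tlift_morph.
rewrite e; apply: eq_tlift => x y.
by rewrite tlift_tens.
Qed.

Lemma sw_mul (U : lmodType K) (F : A -> A -> U) a b : bilin F ->
  \sw_(x, y <- (a * b)) F x y =
  \sw_(a1, a2 <- a) \sw_(b1, b2 <- b) F (a1 * b1) (a2 * b2).
Proof.
move=> Fb; have FE := tlift_linear Fb.
rewrite comulM -[LHS]/(linmap FE _) tlift_morph; apply: eq_tlift => x y.
rewrite tlift_morph; apply: eq_tlift => x' y' /=.
by rewrite tlift_tens.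
Qed.

Lemma sw_counitl (V : lmodType K) (g : {linear A -> V}) a :
  \sw_(x, y <- a) (counit x *: g y) = g a.
Proof.
by rewrite -[in RHS](counitl a) tlift_morph; apply: eq_tlift => x y; rewrite linearZ.
Qed.

Lemma sw_counitr (V : lmodType K) (g : {linear A -> V}) a :
  \sw_(x, y <- a) (counit y *: g x) = g a.
Proof.
by rewrite -[in RHS](counitr a) tlift_morph; apply: eq_tlift => x y; rewrite linearZ.
Qed.

Lemma sw_lin (U : lmodType K) (F : A -> A -> U) : bilin F ->
  linear (fun a => \sw_(x, y <- a) F x y).
Proof. by move=> Fb c a b; rewrite linearP tlift_lin. Qed.

Lemma bilin_mul (B : algType K) (f g : {linear A -> B}) :
  bilin (fun x y => f x * g y).
Proof.
by split=> [w c v v'|v c w w'];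
  rewrite linearP ?mulrDl ?mulrDr -?scalerAl -?scalerAr.
Qed.
End Sweedler.

(* The convolution algebra of linear maps from A to B. For B = K it is the    *)
(* full linear dual of A, with (f * g) a = f a_(1) * g a_(2) and unit counit;  *)
(* the dual Hopf algebra is its subalgebra finite_dual, defined below.         *)
Definition convol (K : fieldType) (A : hopfAlgType K) (B : algType K) : Type :=
  {linear A -> B}.

Section Convolution.
Variables (K : fieldType) (A : hopfAlgType K) (B : algType K).
HB.instance Definition _ := GRing.Lmodule.on (convol A B).
Implicit Types f g h : convol A B.

Definition conv_mul f g : convol A B := linmap (sw_lin (bilin_mul f g)).
Fact conv_one_linear : linear (fun a : A => (counit a : K)%:A : B).
Proof. by move=> c a b; rewrite linearP scalerDl scalerA. Qed.
Definition conv_one : convol A B := linmap conv_one_linear.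

Fact conv_mulA : associative conv_mul.
Proof.
move=> f g h; apply: linmap_eq => a /=.
transitivity (\sw_(x, y <- a) \sw_(y1, y2 <- y) (f x * (g y1 * h y2))).
  by apply: eq_tlift => x y; rewrite /tlift mulr_sumr.
rewrite -sw_coassoc; last first.
  split=> z; last by split=> [w c v v'|v c w w'];
    rewrite linearP ?mulrDl ?mulrDr -?scalerAl -?scalerAr.
  by split=> [w c v v'|v c w w'];
    rewrite linearP ?mulrDl ?mulrDr -?scalerAl -?scalerAr -?scalerAr.
by apply: eq_tlift => x y; rewrite /tlift mulr_suml; apply: eq_bigr => p _; rewrite mulrA.
Qed.
Fact conv_mul1 : left_id conv_one conv_mul.
Proof.
move=> f; apply: linmap_eq => a /=; rewrite -[RHS]sw_counitl.
by apply: eq_tlift => x y; rewrite -scalerAl mul1r.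
Qed.
Fact conv_1mul : right_id conv_one conv_mul.
Proof.
move=> f; apply: linmap_eq => a /=; rewrite -[RHS]sw_counitr.
by apply: eq_tlift => x y; rewrite -scalerAr mulr1.
Qed.
Fact conv_mulDl : left_distributive conv_mul +%R.
Proof.
move=> f g h; apply: linmap_eq => a /=; rewrite /tlift -big_split /=.
by apply: eq_bigr => p _; rewrite mulrDl.
Qed.
Fact conv_mulDr : right_distributive conv_mul +%R.
Proof.
move=> f g h; apply: linmap_eq => a /=; rewrite /tlift -big_split /=.
by apply: eq_bigr => p _; rewrite mulrDr.
Qed.
HB.instance Definition _ := GRing.Zmodule_isPzRing.Build (convol A B)
  conv_mulA conv_mul1 conv_1mul conv_mulDl conv_mulDr.
Fact conv_oner_neq0 : 1 != 0 :> convol A B.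
Proof.
apply/eqP => /(congr1 (fun f : {linear A -> B} => f 1)) /= /eqP.
by rewrite rmorph1 scale1r; apply/negP/oner_neq0.
Qed.
HB.instance Definition _ := GRing.PzSemiRing_isNonZero.Build (convol A B) conv_oner_neq0.
Fact conv_scaleAl (c : K) f g : c *: (f * g) = (c *: f) * g.
Proof.
apply: linmap_eq => a /=; rewrite /tlift scaler_sumr.
by apply: eq_bigr => p _; rewrite scalerAl.
Qed.
HB.instance Definition _ := GRing.Lmodule_isLalgebra.Build K (convol A B) conv_scaleAl.
Fact conv_scaleAr (c : K) f g : c *: (f * g) = f * (c *: g).
Proof.
apply: linmap_eq => a /=; rewrite /tlift scaler_sumr.
by apply: eq_bigr => p _; rewrite scalerAr.
Qed.
HB.instance Definition _ := GRing.Lalgebra_isAlgebra.Build K (convol A B) conv_scaleAr.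

Lemma convE f g a : (f * g) a = \sw_(x, y <- a) (f x * g y).
Proof. by []. Qed.
Lemma conv1E a : (1 : convol A B) a = (counit a : K)%:A.
Proof. by []. Qed.

Lemma conv_inv_uniq f g h : f * g = 1 -> g * h = 1 -> f = h.
Proof. by move=> fg gh; rewrite -[f]mulr1 -gh mulrA fg mul1r. Qed.
End Convolution.

Section Antipode.
Variables (K : fieldType) (A : hopfAlgType K).

Section Bilinear.
Variables (B : algType K) (F : A -> A -> B).
Hypothesis Fb : bilin F.
Fact lin2_subproof1 a : linear (F a).
Proof. by move=> c x y; case: Fb => _ ->. Qed.
Fact lin2_subproof2 : linear (fun a => linmap (lin2_subproof1 a) : convol A B).
Proof. by move=> c x y; apply: linmap_eq => b /=; case: Fb => ->. Qed.
Definition lin2 : convol A (convol A B) := linmap lin2_subproof2.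
End Bilinear.

Lemma lin2_mulE (B : algType K) (F G : A -> A -> B) (Fb : bilin F) (Gb : bilin G) a b :
  (lin2 Fb * lin2 Gb) a b =
  \sw_(a1, a2 <- a) \sw_(b1, b2 <- b) (F a1 b1 * G a2 b2).
Proof. by rewrite convE /tlift lin_sumE. Qed.

Lemma lin2_eq1 (B : algType K) (X : convol A (convol A B)) :
  (forall a b, X a b = (counit a * counit b : K)%:A) -> X = 1.
Proof.
move=> XE; apply: linmap_eq => a; apply: linmap_eq => b.
by rewrite XE conv1E /= scalerA.
Qed.

Lemma antipode1 : antipode (1 : A) = 1.
Proof.
have := antipodel (1 : A); rewrite comul1 tlift_tens ?mulr1 ?rmorph1 ?scale1r //.
exact: (bilin_mul antipode idfun).
Qed.

Lemma bilin_antipodeM : bilin (fun a b : A => antipode (a * b)).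
Proof.
by split=> [w c v v'|v c w w'];
  rewrite ?mulrDl ?mulrDr -?scalerAl -?scalerAr linearP.
Qed.
Lemma bilin_Mantipode : bilin (fun a b : A => antipode b * antipode a).
Proof.
by split=> [w c v v'|v c w w'];
  rewrite linearP ?mulrDl ?mulrDr -?scalerAl -?scalerAr.
Qed.

Lemma antipodeM (a b : A) : antipode (a * b) = antipode b * antipode a.
Proof.
have Mb := bilin_mul (idfun : {linear A -> A}) idfun.
have e : lin2 bilin_antipodeM = lin2 bilin_Mantipode; last first.
  exact: (congr1 (fun f : convol A (convol A A) => f a b) e).
apply: (@conv_inv_uniq _ A _ _ (lin2 Mb)); apply: lin2_eq1 => x y;
  rewrite lin2_mulE.
  rewrite -(sw_mul _ _ (bilin_mul antipode idfun)) /= antipodel.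
  by rewrite rmorphM.
transitivity (\sw_(a1, a2 <- x) ((counit y : K) *: (a1 * antipode a2))).
  apply: eq_tlift => a1 a2; transitivity
    (a1 * (\sw_(b1, b2 <- y) (b1 * antipode b2)) * antipode a2).
    rewrite /tlift mulr_sumr mulr_suml; apply: eq_bigr => p _ /=.
    by rewrite !mulrA.
  by rewrite antipoder -scalerAr mulr1 -scalerAl.
by rewrite /tlift -scaler_sumr [X in _ *: X]antipoder scalerA mulrC.
Qed.
End Antipode.

Section DualAction.
Variables (K : fieldType) (A : hopfAlgType K).

(* The antipode of the dual Hopf algebra, f |-> f o S. *)
Definition dual_antipode (f : convol A K^o) : convol A K^o := f \o antipode.

Lemma bilin_lact (f : convol A K^o) : bilin (fun x y : A => (f y : K) *: x).
Proof.
split=> [w c v v'|v c w w']; first by rewrite scalerDr !scalerA mulrC.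
by rewrite linearP scalerDl scalerA.
Qed.

(* lact f a = a_(1) <f, a_(2)>, as an element of L(A). *)
Definition lact (f : convol A K^o) : endo A := linmap (sw_lin (bilin_lact f)).

Arguments lact : simpl never.

Lemma lactE f a : lact f a = \sw_(x, y <- a) ((f y : K) *: x).
Proof. by []. Qed.

Lemma lact_linear : linear lact.
Proof.
move=> c f g; apply: linmap_eq => a; rewrite lin_addE lin_scaleE !lactE -tliftP.
by apply: eq_tlift => x y; rewrite lin_addE lin_scaleE scalerDl scalerA.
Qed.
HB.instance Definition _ :=
  GRing.isLinear.Build K (convol A K^o) (endo A) *:%R lact lact_linear.

Lemma lact1 : lact 1 = 1.
Proof.
apply: linmap_eq => a; rewrite lactE -[RHS](counitr a).
by apply: eq_tlift => x y; rewrite conv1E [_ *: 1]mulr1.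
Qed.

Lemma lact_mul (f : convol A K^o) (I : finType) (g h : I -> convol A K^o) :
  (forall a b, f (a * b) = \sum_i g i a * h i b) ->
  forall a b, lact f (a * b) = \sum_i lact (g i) a * lact (h i) b.
Proof.
move=> fM a b; rewrite lactE sw_mul; last exact: bilin_lact.
transitivity (\sum_i \sw_(a1, a2 <- a) \sw_(b1, b2 <- b)
   (((g i a2 : K) *: a1) * ((h i b2 : K) *: b1))).
  rewrite /tlift [RHS]exchange_big; apply: eq_bigr => p _.
  rewrite [RHS]exchange_big; apply: eq_bigr => q _ /=.
  rewrite fM scaler_suml; apply: eq_bigr => i _.
  by rewrite -scalerAl -scalerAr scalerA.
apply: eq_bigr => i _; rewrite !lactE /tlift mulr_suml.
by apply: eq_bigr => p _; rewrite mulr_sumr.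
Qed.

Lemma lact_at1 f : lact f 1 = (f 1 : K)%:A.
Proof. by rewrite lactE comul1 tlift_tens //; apply: bilin_lact. Qed.
End DualAction.

(* rform_inv is the inverse of rform in the convolution algebra of linear     *)
(* functionals on A (x) A, whose unit is counit (x) counit.                    *)
Record universal_r_form (K : fieldType) (A : hopfAlgType K) := UniversalRForm {
  rform :> {linear tensor A A -> K^o};
  rform_inv : {linear tensor A A -> K^o};
  rformK : forall a b,
    \sw_(a1, a2 <- a) \sw_(b1, b2 <- b)
      (rform (tens a1 b1) * rform_inv (tens a2 b2)) = counit a * counit b;
  rformVK : forall a b,
    \sw_(a1, a2 <- a) \sw_(b1, b2 <- b)
      (rform_inv (tens a1 b1) * rform (tens a2 b2)) = counit a * counit b;
  rform_mull : forall a b c, rform (tens (a * b) c) =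
    \sw_(c1, c2 <- c) (rform (tens a c1) * rform (tens b c2));
  rform_mulr : forall a b c, rform (tens a (b * c)) =
    \sw_(a1, a2 <- a) (rform (tens a1 c) * rform (tens a2 b));
  rform_comm : forall a b,
    \sw_(a1, a2 <- a) \sw_(b1, b2 <- b)
      ((rform (tens a1 b1) : K) *: (a2 * b2)) =
    \sw_(a1, a2 <- a) \sw_(b1, b2 <- b)
      ((rform (tens a2 b2) : K) *: (b1 * a1)) }.

(* The row index is the upper index of the corepresentation: v k l is v^k_l. *)
Record matrix_corep (K : fieldType) (A : hopfAlgType K) (n : nat) := MatrixCorep {
  corep_mx :> 'M[A]_n;
  corep_comul : forall k l,
    comul (corep_mx k l) = \sum_j tens (corep_mx k j) (corep_mx j l);
  corep_counit : forall k l, counit (corep_mx k l) = (k == l)%:R }.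

Record central_character (K : fieldType) (A : hopfAlgType K) := CentralCharacter {
  central_char :> {lrmorphism A -> K^o};
  central_charP : forall a : A,
    \sw_(a1, a2 <- a) ((central_char a1 : K) *: a2) =
    \sw_(a1, a2 <- a) ((central_char a2 : K) *: a1) }.

Section LFunctionals.
Variables (K : fieldType) (A : hopfAlgType K) (r : universal_r_form A).
Variables (n : nat) (v : matrix_corep A n).

(* lplus k j and lminus k j are l^{+k}_j and l^{-k}_j. *)
Definition lplus (k j : 'I_n) : convol A K^o := rform r \o tensl (v k j).
Definition lminus (k j : 'I_n) : convol A K^o := rform_inv r \o tens (v k j).

Lemma lplusE k j a : lplus k j a = r (tens a (v k j)). Proof. by []. Qed.
Lemma lminusE k j a : lminus k j a = rform_inv r (tens (v k j) a).
Proof. by []. Qed.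

Lemma sw_corep (U : lmodType K) (F : A -> A -> U) k l : bilin F ->
  \sw_(x, y <- (v k l)) F x y = \sum_j F (v k j) (v j l).
Proof.
move=> Fb; rewrite corep_comul -[LHS]/(linmap (tlift_linear Fb) _) linear_sum /=.
by apply: eq_bigr => j _; rewrite tlift_tens.
Qed.

Lemma lplusM k j a b : lplus k j (a * b) = \sum_m lplus k m a * lplus m j b.
Proof.
rewrite lplusE rform_mull sw_corep //.
exact: (bilin_mul (rform r \o tens a : {linear A -> K^o}) (rform r \o tens b)).
Qed.
End LFunctionals.

Section LMultiplicative.
Variables (K : fieldType) (A : hopfAlgType K) (r : universal_r_form A).

Section Positive.
Variables (n : nat) (v : matrix_corep A n.+1).

Fact rmx_linear (g : {linear tensor A A -> K^o}) :
  linear (fun b : A => \matrix_(i, j) g (tens (v i j) b) : 'M[K]_n.+1).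
Proof. by move=> c x y; apply/matrixP => i j; rewrite !mxE !linearP. Qed.
Definition rmx g : convol A 'M[K]_n.+1 := linmap (rmx_linear g).

Lemma bilin_rr (g h : {linear tensor A A -> K^o}) b :
  bilin (fun x y => \sw_(b1, b2 <- b) (g (tens x b1) * h (tens y b2))).
Proof.
apply: (tlift_bilin (F := fun x y b1 b2 => g (tens x b1) * h (tens y b2))).
move=> x y.
exact: (bilin_mul (g \o tensl x : {linear A -> K^o}) (h \o tensl y)).
Qed.

Lemma rmx_mul (g h : {linear tensor A A -> K^o}) :
  (forall a b : A, \sw_(a1, a2 <- a) \sw_(b1, b2 <- b)
      (g (tens a1 b1) * h (tens a2 b2)) = counit a * counit b) ->
  rmx g * rmx h = 1.
Proof.
move=> gh; apply: linmap_eq => b; apply/matrixP => i j.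
rewrite convE conv1E /tlift summxE.
transitivity (\sw_(a1, a2 <- (v i j)) \sw_(b1, b2 <- b)
      (g (tens a1 b1) * h (tens a2 b2))).
  rewrite (sw_corep _ _ _ (bilin_rr g h b)) exchange_big /=; apply: eq_bigr => p _.
  by rewrite !mxE; apply: eq_bigr => m _; rewrite !mxE.
by rewrite gh corep_counit !mxE mulrC.
Qed.

Lemma rmxM b c : rmx (rform r) (b * c) = rmx (rform r) c * rmx (rform r) b.
Proof.
apply/matrixP => i j; rewrite !mxE rform_mulr sw_corep.
  by apply: eq_bigr => m _; rewrite !mxE.
exact: (bilin_mul (rform r \o tensl c : {linear A -> K^o}) (rform r \o tensl b)).
Qed.

Lemma rmxVM b c :
  rmx (rform_inv r) (b * c) = rmx (rform_inv r) b * rmx (rform_inv r) c.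
Proof.
pose R := rmx (rform r); pose V := rmx (rform_inv r).
have RV : R * V = 1 by apply: rmx_mul; apply: rformK.
have VR : V * R = 1 by apply: rmx_mul; apply: rformVK.
have VMb : bilin (fun x y : A => V (x * y)).
  by split=> [w a x x'|x a w w']; rewrite ?mulrDl ?mulrDr -?scalerAl -?scalerAr linearP.
have RMb : bilin (fun x y : A => R (x * y)).
  by split=> [w a x x'|x a w w']; rewrite ?mulrDl ?mulrDr -?scalerAl -?scalerAr linearP.
have VVb : bilin (fun x y : A => V x * V y) by apply: bilin_mul.
have e : lin2 VVb = lin2 VMb; last first.
  by have /(congr1 (fun f : convol A (convol A 'M[K]_n.+1) => f b c)) := e.
apply: (@conv_inv_uniq _ A _ _ (lin2 RMb)); apply: lin2_eq1 => x y;
  rewrite lin2_mulE.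
  transitivity (\sw_(x1, x2 <- x) (V x1 * (\sw_(y1, y2 <- y) (V y1 * R y2)) * R x2)).
    apply: eq_tlift => x1 x2; rewrite /tlift mulr_sumr mulr_suml.
    by apply: eq_bigr => p _; rewrite rmxM !mulrA.
  rewrite -[\sw_(_, _ <- y) _]/((V * R) y) VR conv1E.
  transitivity (\sw_(x1, x2 <- x) ((counit y : K) *: (V x1 * R x2))).
    by apply: eq_tlift => x1 x2; rewrite -scalerAr mulr1 -scalerAl.
  rewrite /tlift -scaler_sumr -[X in _ *: X]/((V * R) x) VR conv1E.
  by rewrite scalerA mulrC.
rewrite -(sw_mul _ _ (bilin_mul R V)) -[LHS]/((R * V) (x * y)) RV conv1E.
by rewrite rmorphM.
Qed.

Lemma rmxV1 : rmx (rform_inv r) 1 = 1.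
Proof.
have : (rmx (rform r) * rmx (rform_inv r)) 1 = 1.
  by rewrite (rmx_mul (rformK r)) conv1E rmorph1 scale1r.
rewrite convE comul1 tlift_tens; last exact: bilin_mul.
have := rmxM 1 1; rewrite mulr1.
move: (rmx (rform r) 1) (rmx (rform_inv r) 1) => R1 V1 RR RV.
have R1E : R1 = 1 by rewrite -[R1]mulr1 -RV mulrA -RR.
by rewrite -RV R1E mul1r.
Qed.
End Positive.

Variables (n : nat) (v : matrix_corep A n).
Local Notation lm := (lminus r v).
Local Notation lp := (lplus r v).

Lemma lminusM k j a b : lm k j (a * b) = \sum_m lm k m a * lm m j b.
Proof.
case: n v k j => [v0 [] //|m w] k j; have /matrixP/(_ k j) := rmxVM w a b.
by rewrite !mxE lminusE => ->; apply: eq_bigr => i _; rewrite !mxE.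
Qed.

Lemma lminus_at1 k j : lm k j 1 = (k == j)%:R.
Proof.
case: n v k j => [v0 [] //|m w] k j; have /matrixP/(_ k j) := rmxV1 w.
by rewrite !mxE lminusE.
Qed.

Lemma lplus_at1 k j : lp k j 1 = (k == j)%:R.
Proof.
case: n v k j => [v0 [] //|m w] k j.
pose L := \matrix_(i, j) rform r (tens 1 (w i j)) : 'M[K]_m.+1.
pose L' := \matrix_(i, j) rform_inv r (tens 1 (w i j)) : 'M[K]_m.+1.
have LL : L * L = L.
  apply/matrixP => s t; rewrite !mxE; have := lplusM r w s t 1 1.
  rewrite mulr1 lplusE => ->; apply: eq_bigr => i _.
  by rewrite !mxE !lplusE.
have LL' : L * L' = 1.
  apply/matrixP => s t; have := rformK r 1 (w s t).
  rewrite comul1 tlift_tens; last exact: bilin_rr.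
  rewrite sw_corep; last first.
    exact: (bilin_mul (rform r \o tens 1 : {linear A -> K^o}) (rform_inv r \o tens 1)).
  rewrite rmorph1 mul1r corep_counit !mxE => <-.
  by apply: eq_bigr => i _; rewrite !mxE.
have : L = 1 by rewrite -[L]mulr1 -LL' mulrA LL.
by move/matrixP/(_ k j); rewrite !mxE lplusE.
Qed.
End LMultiplicative.

Section Calculus.
Variables (K : fieldType) (A : hopfAlgType K) (r : universal_r_form A).
Variables (n : nat) (v : matrix_corep A n) (zeta : central_character A).
Local Notation dualA := (convol A K^o).
Local Notation lm := (lminus r v).
Local Notation lp := (lplus r v).

(* lfun k j is l^k_j, ftheta k j s t is f^{kj}_{st}, Acoef j k is A^j_k. *)
Definition lfun (k j : 'I_n) : dualA :=
  \sum_t dual_antipode (lm k t) * lp t j.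

Definition ftheta (k j s t : 'I_n) : dualA :=
  (central_char zeta : dualA) * dual_antipode (lm s k) * lp j t.

Definition Xfun (k j : 'I_n) : dualA :=
  (central_char zeta : dualA) * lfun k j - (k == j)%:R *: 1.

Definition Acoef (j k : 'I_n) : K :=
  \sum_s rform r (tens (antipode (antipode (v j s))) (v s k)).

Definition Cfun : dualA := \sum_k \sum_j Acoef j k *: Xfun k j.

Lemma dual_antipode_lminusM s k a b :
  dual_antipode (lm s k) (a * b) =
  \sum_p dual_antipode (lm p k) a * dual_antipode (lm s p) b.
Proof.
rewrite -[LHS]/(lm s k (antipode (a * b))) antipodeM lminusM.
by apply: eq_bigr => p _; rewrite mulrC.
Qed.

Lemma conv_evalM (f g : dualA) (I J : finType) (f1 f2 : I -> dualA)
    (g1 g2 : J -> dualA) a b :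
  (forall a b, f (a * b) = \sum_i f1 i a * f2 i b) ->
  (forall a b, g (a * b) = \sum_j g1 j a * g2 j b) ->
  (f * g) (a * b) = \sum_i \sum_j (f1 i * g1 j) a * (f2 i * g2 j) b.
Proof.
move=> fM gM; rewrite convE sw_mul; last exact: bilin_mul.
rewrite pair_bigA /=; transitivity (\sum_(u : I * J)
  \sw_(a1, a2 <- a) \sw_(b1, b2 <- b)
    ((f1 u.1 a1 * g1 u.2 a2) * (f2 u.1 b1 * g2 u.2 b2))).
  rewrite /tlift [RHS]exchange_big; apply: eq_bigr => p _.
  rewrite [RHS]exchange_big; apply: eq_bigr => q _ /=.
  rewrite fM gM big_distrlr pair_bigA /=; apply: eq_bigr => u _.
  by rewrite mulrACA.
apply: eq_bigr => u _; rewrite /= /tlift mulr_suml.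
by apply: eq_bigr => p _; rewrite mulr_sumr.
Qed.

Lemma fthetaM k j s t a b : ftheta k j s t (a * b) =
  \sum_p \sum_q ftheta k j p q a * ftheta p q s t b.
Proof.
rewrite /ftheta -mulrA.
pose h (p q : 'I_n) (k j : 'I_n) := dual_antipode (lm p k) * lp j q.
have hM (x y : A) : h s t k j (x * y) =
    \sum_(u : 'I_n * 'I_n) h u.1 u.2 k j x * h s t u.1 u.2 y.
  rewrite -(pair_bigA _ (fun p q => h p q k j x * h s t p q y)).
  rewrite (conv_evalM _ _ (dual_antipode_lminusM s k) (lplusM r v j t)).
  by [].
rewrite (@conv_evalM _ _ unit _ (fun=> central_char zeta : dualA)
  (fun=> central_char zeta : dualA) _ _ a b _ hM); last first.
  by move=> x y; rewrite (big_pred1 tt) => [|[]] //; rewrite rmorphM.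
rewrite (big_pred1 tt) => [|[]] //; rewrite pair_bigA.
by apply: eq_bigr => u _; rewrite /ftheta -!mulrA.
Qed.

Lemma ftheta_at1 k j s t : ftheta k j s t 1 = ((s, t) == (k, j))%:R.
Proof.
rewrite /ftheta convE comul1 tlift_tens; last exact: bilin_mul.
rewrite convE comul1 tlift_tens; last exact: bilin_mul.
rewrite rmorph1 mul1r lplus_at1 -[dual_antipode _ _]/(lm s k (antipode 1)).
rewrite antipode1 lminus_at1.
by rewrite -natrM mulnb -pair_eqE /= [j == t]eq_sym.
Qed.
End Calculus.

Arguments lplus : simpl never.
Arguments lminus : simpl never.
Arguments dual_antipode : simpl never.
Arguments ftheta : simpl never.
Arguments Cfun : simpl never.

(* Bimodules over a K-algebra: K acts in the same way on both sides. *)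
HB.mixin Record isBimodule (K : fieldType) (A : algType K) M
    of GRing.Lmodule A M := {
  ract : M -> A -> M;
  ractDl : forall w w' a, ract (w + w') a = ract w a + ract w' a;
  ractDr : forall w a b, ract w (a + b) = ract w a + ract w b;
  ract1 : forall w, ract w 1 = w;
  ractA : forall w a b, ract (ract w a) b = ract w (a * b);
  ractZ : forall a w b, ract (a *: w) b = a *: ract w b;
  ract_scalar : forall w (c : K), ract w c%:A = c%:A *: w
}.
#[short(type="bimodType")]
HB.structure Definition Bimodule (K : fieldType) (A : algType K) :=
  {M of GRing.Lmodule A M & isBimodule K A M}.

Record fodc (K : fieldType) (A : algType K) := FODC {
  fodc_bimod :> bimodType A;
  fodc_d : A -> fodc_bimod;
  fodc_d_linear : forall (c : K) a b,
    fodc_d (c *: a + b) = c%:A *: fodc_d a + fodc_d b;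
  fodc_leibniz : forall a b,
    fodc_d (a * b) = a *: fodc_d b + ract (fodc_d a) b;
  fodc_span : forall w : fodc_bimod, exists s : seq (A * A),
    w = \sum_(p <- s) p.1 *: fodc_d p.2 }.

Section FreeBimodule.
Variables (K : fieldType) (A : hopfAlgType K) (r : universal_r_form A).
Variables (n : nat) (v : matrix_corep A n) (zeta : central_character A).
Local Notation F := (ftheta r v zeta).

(* The matrix w stands for \sum_(k, j) w k j *: theta_(k, j). *)
Definition free_bimod : Type := 'M[A]_n.
HB.instance Definition _ := GRing.Lmodule.on free_bimod.

Definition free_ract (w : free_bimod) (a : A) : free_bimod :=
  \matrix_(s, t) \sum_k \sum_j w k j * lact (F k j s t) a.

Fact free_ractDl w w' a : free_ract (w + w') a = free_ract w a + free_ract w' a.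
Proof.
apply/matrixP => s t; rewrite !mxE -big_split; apply: eq_bigr => k _.
by rewrite -big_split; apply: eq_bigr => j _; rewrite !mxE mulrDl.
Qed.
Fact free_ractDr w a b : free_ract w (a + b) = free_ract w a + free_ract w b.
Proof.
apply/matrixP => s t; rewrite !mxE -big_split; apply: eq_bigr => k _.
by rewrite -big_split; apply: eq_bigr => j _; rewrite linearD mulrDr.
Qed.
Fact free_ractZ a w b : free_ract (a *: w) b = a *: free_ract w b.
Proof.
apply/matrixP => s t; rewrite !mxE mulr_sumr; apply: eq_bigr => k _.
by rewrite mulr_sumr; apply: eq_bigr => j _; rewrite !mxE mulrA.
Qed.
Fact free_ract_scalar w (c : K) : free_ract w c%:A = c%:A *: w.
Proof.
have FE k j s t : lact (F k j s t) c%:A = c%:A * ((s, t) == (k, j))%:R.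
  rewrite linearZ lact_at1 ftheta_at1 -scalerAl mul1r; congr (_ *: _).
  by case: eqP => _; rewrite ?scale1r ?scale0r.
apply/matrixP => s t; rewrite !mxE.
under eq_bigr do under eq_bigr do rewrite FE.
rewrite (bigD1 s) //= (bigD1 t) //= eqxx mulr1.
rewrite -scalerAr mulr1 -scalerAl mul1r !big1 ?addr0 // => [k ks|j jt].
  by rewrite big1 // => j _; rewrite xpair_eqE [s == k]eq_sym (negPf ks) !mulr0.
by rewrite xpair_eqE [t == j]eq_sym (negPf jt) andbF !mulr0.
Qed.
Fact free_ract1 w : free_ract w 1 = w.
Proof. by have := free_ract_scalar w 1; rewrite !scale1r. Qed.
Fact free_ractA w a b : free_ract (free_ract w a) b = free_ract w (a * b).
Proof.
have exch (G : 'I_n -> 'I_n -> 'I_n -> 'I_n -> A) (H : 'I_n -> 'I_n -> A) :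
    \sum_p \sum_q (\sum_k \sum_j G k j p q) * H p q =
    \sum_k \sum_j \sum_p \sum_q G k j p q * H p q.
  transitivity (\sum_p \sum_k \sum_j \sum_q G k j p q * H p q).
    apply: eq_bigr => p _; transitivity (\sum_q \sum_k \sum_j G k j p q * H p q).
      apply: eq_bigr => q _; rewrite mulr_suml; apply: eq_bigr => k _.
      by rewrite mulr_suml.
    by rewrite exchange_big; apply: eq_bigr => k _; rewrite exchange_big.
  by rewrite exchange_big; apply: eq_bigr => k _; rewrite exchange_big.
apply/matrixP => s t; rewrite !mxE; under eq_bigr do under eq_bigr do rewrite mxE.
rewrite exch.
apply: eq_bigr => k _; apply: eq_bigr => j _.
rewrite (@lact_mul _ _ _ _ (fun u : 'I_n * 'I_n => F k j u.1 u.2)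
                           (fun u => F u.1 u.2 s t)); last first.
  by move=> x y; rewrite fthetaM pair_bigA.
rewrite pair_bigA mulr_sumr; apply: eq_bigr => u _.
by rewrite mulrA.
Qed.
HB.instance Definition _ := isBimodule.Build K A free_bimod
  free_ractDl free_ractDr free_ract1 free_ractA free_ractZ free_ract_scalar.

(* The right action of free_bimod, free_ract, is the one given on the basis   *)
(* by theta_ract.                                                              *)
Definition theta (k j : 'I_n) : free_bimod := delta_mx k j.
Lemma theta_ract k j a :
  ract (theta k j) a = \sum_s \sum_t lact (F k j s t) a *: theta s t.
Proof.
apply/matrixP => s t; rewrite !mxE (bigD1 k) //= (bigD1 j) //=.
rewrite !mxE !eqxx mul1r big1 ?addr0 => [|j' jj']; last first.
  by rewrite !mxE (negPf jj') andbF mul0r.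
rewrite big1 ?addr0 => [|k' kk']; last first.
  by rewrite big1 // => j' _; rewrite !mxE (negPf kk') mul0r.
rewrite summxE (bigD1 s) //= summxE (bigD1 t) //= !mxE !eqxx mulr1.
rewrite !big1 ?addr0 // => [s' ss'|t' tt'].
  by rewrite summxE big1 // => t' _; rewrite !mxE [s == s']eq_sym (negPf ss') mulr0.
by rewrite !mxE [t == t']eq_sym (negPf tt') andbF mulr0.
Qed.

Definition theta_sum : free_bimod := \sum_k theta k k.
Definition free_d (a : A) : free_bimod := ract theta_sum a - a *: theta_sum.

Fact free_d_linear (c : K) a b : free_d (c *: a + b) = c%:A *: free_d a + free_d b.
Proof.
have cE : c *: a = c%:A * a by rewrite -scalerAl mul1r.
rewrite /free_d ractDr cE -ractA ract_scalar ractZ scalerDl -scalerA.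
by rewrite scalerBr opprD addrACA.
Qed.

Fact free_d_leibniz a b : free_d (a * b) = a *: free_d b + ract (free_d a) b.
Proof.
rewrite /free_d ractDl -[- (a *: theta_sum)]scaleNr ractZ ractA.
by rewrite scalerBr scalerA scaleNr [RHS]addrC addrA subrK.
Qed.

(* The sub-bimodule A . dA . A. *)
Definition Gamma_pred : {pred free_bimod} := fun w =>
  `[< exists s : seq (A * A * A),
        w = \sum_(p <- s) p.1.1 *: ract (free_d p.1.2) p.2 >].

Fact Gamma_submod : submod_closed Gamma_pred.
Proof.
split=> [|a w w' /asboolP [s ->] /asboolP [s' ->]]; apply/asboolP.
  by exists [::]; rewrite big_nil.
exists ([seq (a * p.1.1, p.1.2, p.2) | p <- s] ++ s').
rewrite big_cat big_map scaler_sumr; congr (_ + _).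
by apply: eq_bigr => p _; rewrite scalerA.
Qed.
HB.instance Definition _ := GRing.isSubmodClosed.Build A free_bimod Gamma_pred Gamma_submod.
Record Gamma : Type := MkGamma { Gamma_val : free_bimod; _ : Gamma_val \in Gamma_pred }.
HB.instance Definition _ := [isSub for Gamma_val].
HB.instance Definition _ := [Choice of Gamma by <:].
HB.instance Definition _ := [SubChoice_isSubLmodule of Gamma by <:].

Fact Gamma_ract_subproof (w : Gamma) a : ract (Gamma_val w) a \in Gamma_pred.
Proof.
case: w => /= w /asboolP [s ->]; apply/asboolP.
exists [seq (p.1.1, p.1.2, p.2 * a) | p <- s]; rewrite big_map.
have r0 : ract (0 : free_bimod) a = 0.
  by apply: (addrI (ract (0 : free_bimod) a)); rewrite -ractDl !addr0.
elim: s => [|p s IHs]; first by rewrite !big_nil.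
by rewrite !big_cons ractDl IHs ractZ ractA.
Qed.
Definition Gamma_ract (w : Gamma) (a : A) : Gamma := MkGamma (Gamma_ract_subproof w a).

Fact Gamma_ractDl w w' a : Gamma_ract (w + w') a = Gamma_ract w a + Gamma_ract w' a.
Proof. by apply: val_inj; rewrite /= ractDl. Qed.
Fact Gamma_ractDr w a b : Gamma_ract w (a + b) = Gamma_ract w a + Gamma_ract w b.
Proof. by apply: val_inj; rewrite /= ractDr. Qed.
Fact Gamma_ract1 w : Gamma_ract w 1 = w.
Proof. by apply: val_inj; rewrite /= ract1. Qed.
Fact Gamma_ractA w a b : Gamma_ract (Gamma_ract w a) b = Gamma_ract w (a * b).
Proof. by apply: val_inj; rewrite /= ractA. Qed.
Fact Gamma_ractZ a w b : Gamma_ract (a *: w) b = a *: Gamma_ract w b.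
Proof. by apply: val_inj; rewrite /= ractZ. Qed.
Fact Gamma_ract_scalar w (c : K) : Gamma_ract w c%:A = c%:A *: w.
Proof. by apply: val_inj; rewrite /= ract_scalar. Qed.
HB.instance Definition _ := isBimodule.Build K A Gamma
  Gamma_ractDl Gamma_ractDr Gamma_ract1 Gamma_ractA Gamma_ractZ Gamma_ract_scalar.

Fact Gamma_d_subproof a : free_d a \in Gamma_pred.
Proof.
by apply/asboolP; exists [:: (1, a, 1)]; rewrite big_seq1 scale1r ract1.
Qed.
Definition Gamma_d (a : A) : Gamma := MkGamma (Gamma_d_subproof a).

Fact Gamma_d_linear (c : K) a b : Gamma_d (c *: a + b) = c%:A *: Gamma_d a + Gamma_d b.
Proof. by apply: val_inj; rewrite /= free_d_linear. Qed.
Fact Gamma_leibniz a b : Gamma_d (a * b) = a *: Gamma_d b + ract (Gamma_d a) b.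
Proof. by apply: val_inj; rewrite /= free_d_leibniz. Qed.
Fact Gamma_span (w : Gamma) : exists s : seq (A * A),
  w = \sum_(p <- s) p.1 *: Gamma_d p.2.
Proof.
case: w => w wP; have /asboolP [s wE] := wP.
exists (flatten [seq [:: (p.1.1, p.1.2 * p.2); (- (p.1.1 * p.1.2), p.2)] | p <- s]).
apply: val_inj => /=; rewrite wE (big_morph Gamma_val (fun _ _ => erefl) erefl); elim: s {wP wE} => [|p s IHs].
  by rewrite !big_nil.
rewrite /= !big_cons IHs /= !addrA; congr (_ + _).
rewrite free_d_leibniz scalerDr scalerA scaleNr.
by rewrite addrAC subrr add0r.
Qed.

Definition Gamma_fodc : fodc A :=
  FODC Gamma_d_linear Gamma_leibniz Gamma_span.
End FreeBimodule.

Section FiniteDual.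
Variables (K : fieldType) (A : hopfAlgType K).

(* The functionals f whose coproduct (a, b) |-> f (a * b) lies in A' (x) A'. *)
Definition finite_dual (f : convol A K^o) : Prop :=
  exists s : seq (convol A K^o * convol A K^o),
    forall a b, f (a * b) = \sum_(p <- s) p.1 a * p.2 b.

Lemma finite_dual_lin (c : K) f g :
  finite_dual f -> finite_dual g -> finite_dual (c *: f + g).
Proof.
move=> [s fM] [t gM]; exists ([seq (c *: p.1, p.2) | p <- s] ++ t) => a b.
rewrite lin_addE lin_scaleE fM gM big_cat big_map scaler_sumr; congr (_ + _).
by apply: eq_bigr => p _; rewrite lin_scaleE -scalerAl.
Qed.

Lemma finite_dual0 : finite_dual 0.
Proof. by exists [::] => a b; rewrite big_nil. Qed.

Lemma finite_dual1 : finite_dual 1.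
Proof. by exists [:: (1, 1)] => a b; rewrite big_seq1 !conv1E rmorphM ![_%:A]mulr1. Qed.

Lemma finite_dual_sum (I : Type) (s : seq I) F :
  (forall i, finite_dual (F i)) -> finite_dual (\sum_(i <- s) F i).
Proof.
move=> Ff; elim: s => [|i s IHs]; first by rewrite big_nil; apply: finite_dual0.
by rewrite big_cons -[F i]scale1r; apply: finite_dual_lin.
Qed.

Lemma finite_dual_ftheta r n (v : matrix_corep A n) zeta k j s t :
  finite_dual (ftheta r v zeta k j s t).
Proof.
exists [seq (ftheta r v zeta k j p.1 p.2, ftheta r v zeta p.1 p.2 s t)
          | p : 'I_n * 'I_n] => a b.
by rewrite fthetaM pair_bigA big_map big_enum.
Qed.

Lemma finite_dual_Cfun r n (v : matrix_corep A n) zeta :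
  finite_dual (Cfun r v zeta).
Proof.
apply: finite_dual_sum => k; apply: finite_dual_sum => j.
rewrite -[_ *: _]addr0; apply: finite_dual_lin finite_dual0.
rewrite /Xfun addrC -scaleNr; apply: finite_dual_lin; first exact: finite_dual1.
rewrite /lfun mulr_sumr; apply: finite_dual_sum => i; rewrite mulrA.
exact: (finite_dual_ftheta r v zeta i i k j).
Qed.
End FiniteDual.

(* Linearity of tau is over the ground field, which acts on the left A-module  *)
(* G through c |-> c%:A.                                                       *)
Definition is_commutator_rep (R : realType) (A : algType R[i]) (G : fodc A)
    (B : algType R[i]) (rho : {lrmorphism A -> B}) (C : B) : Prop :=
  exists tau : G -> B,
    (forall (c : R[i]) (w w' : G), tau (c%:A *: w + w') = c *: tau w + tau w') /\
    (forall a b : A,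
       tau (a *: fodc_d G b) = ('i%C : R[i]) *: (rho a * (C * rho b - rho b * C))).

(* Main.v *)
Require Import Defs.
From mathcomp Require Import all_boot all_order all_algebra.
From mathcomp Require Import boolp reals complex.

(** A left A-linear functional l : Gamma -> A on any first order calculus
    yields a commutator representation: with C = l o d, the Leibniz rule
    d(bx) = b dx + (db) x gives

      (C b - b C) x = l (d (b x)) - b l (dx) = l (db x),

    and hence a (C b - b C) x = l ((a db) x).  So tau w := i l (w _) is a map
    defined on all of Gamma without choosing an expression of w as a sum of
    terms a db; well-definedness costs nothing ([left_linear_commutator_rep]).

    It remains to recognise C_{v,zeta} as such a composite.  Since
    \sum_k f^{kk}_{st} = zeta l^s_t, the theta_{st} coordinate of da is the
    action of X_{st} on a ([free_dE]), whence C_{v,zeta} |> a = l (da) for the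
    left A-linear map with l (theta_{st}) = A^t_s ([lact_Cfun]). *)

Set Implicit Arguments.
Unset Strict Implicit.
Unset Printing Implicit Defensive.
Import GRing.Theory.
Local Open Scope ring_scope.

Section LeftLinearFunctionals.
Variables (R : realType) (A : algType R[i]) (G : fodc A) (l : G -> A).
Hypothesis l_linear : forall a w w', l (a *: w + w') = a * l w + l w'.

Lemma ract_alg (w : G) (c : R[i]) x y :
  ract w (c *: x + y) = c%:A *: ract w x + ract w y.
Proof.
have -> : c *: x = c%:A * x by rewrite -scalerAl mul1r.
by rewrite ractDr -ractA ract_scalar ractZ.
Qed.

Fact commutator_tau_subproof (w : G) :
  linear (fun x => ('i%C : R[i]) *: l (ract w x)).
Proof.
move=> c x y.
by rewrite ract_alg l_linear -scalerAl mul1r scalerDr !scalerA [_ * c]mulrC.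
Qed.
Definition commutator_tau (w : G) : endo A :=
  linmap (commutator_tau_subproof w).

(** The Leibniz rule says exactly that the commutator of l o d with b is
    l ((db) _), which depends on db only. *)
Lemma left_linear_commutator_rep (C : endo A) :
  (forall a, C a = l (fodc_d G a)) ->
  is_commutator_rep G (@lmul R[i] A : {lrmorphism A -> endo A}) C.
Proof.
move=> CE; exists commutator_tau; split=> [c w w'|a b]; apply: linmap_eq => x.
  rewrite lin_addE lin_scaleE /= ractDl ractZ l_linear -scalerAl mul1r.
  by rewrite scalerDr !scalerA mulrC.
have l0 : l 0 = 0.
  by have := l_linear (-1) 0 0; rewrite scaler0 add0r mulN1r addNr.
rewrite lin_scaleE -[LHS]/('i%C *: l (ract (a *: fodc_d G b) x)); congr (_ *: _).
rewrite ractZ -[a *: _]addr0 l_linear l0 addr0.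
rewrite -[RHS]/(a * ((C * lmul b - lmul b * C : {linear A -> A}) x)).
rewrite lin_addE lin_oppE -[(C * _ : {linear A -> A}) x]/(C (b * x)).
rewrite -[(_ * C : {linear A -> A}) x]/(b * C x) !CE fodc_leibniz l_linear.
by rewrite addrC addKr.
Qed.

End LeftLinearFunctionals.

Section ThetaCoordinates.
Variables (K : fieldType) (A : hopfAlgType K) (r : universal_r_form A).
Variables (n : nat) (v : matrix_corep A n) (zeta : central_character A).

Lemma theta_sumE k j : theta_sum A n k j = (k == j)%:R.
Proof.
rewrite /theta_sum summxE (bigD1 k) //= mxE eqxx eq_sym.
rewrite big1 ?addr0 // => k' kk'.
by rewrite mxE [k == k']eq_sym (negPf kk').
Qed.

(** In da = theta . a - a . theta, the first term has (s, t)-coordinate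
    \sum_k f^{kk}_{st} |> a = (zeta l^s_t) |> a, and the second one accounts
    for the scalar term delta_{st} of X_{st}. *)
Lemma free_dE a s t : free_d r v zeta a s t = lact (Xfun r v zeta s t) a.
Proof.
have -> : free_d r v zeta a s t =
    free_ract r v zeta (theta_sum A n) a s t - a * theta_sum A n s t.
  by rewrite !mxE.
rewrite theta_sumE mxE /Xfun /lfun mulr_sumr linearB linear_sum.
rewrite lin_addE lin_oppE lin_sumE.
have -> : lact ((s == t)%:R *: 1) a = (s == t)%:R *: a.
  rewrite linearZ lin_scaleE; congr (_ *: _).
  exact: (congr1 (fun f : endo A => (f : {linear A -> A}) a) (lact1 A)).
congr (_ - _).
  apply: eq_bigr => k _; rewrite (bigD1 k) // theta_sumE eqxx mul1r.
  rewrite /ftheta -mulrA.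
  rewrite big1 => [|j /andP[_ jk]]; first exact: addr0.
  by rewrite theta_sumE eq_sym (negPf jk) mul0r.
by case: (s == t); rewrite ?mulr1 ?mulr0 ?scale1r ?scale0r.
Qed.

(** The left linear map l with l (theta_{st}) = A^t_s, in coordinates. *)
Definition Acontract (w : 'M[A]_n) : A :=
  \sum_s \sum_t Acoef r v t s *: w s t.

Lemma Acontract_linear a w w' :
  Acontract (a *: w + w') = a * Acontract w + Acontract w'.
Proof.
rewrite /Acontract mulr_sumr -big_split; apply: eq_bigr => s _ /=.
rewrite mulr_sumr -big_split; apply: eq_bigr => t _ /=.
by rewrite !mxE scalerDr scalerAr.
Qed.

Lemma lact_Cfun a : lact (Cfun r v zeta) a = Acontract (free_d r v zeta a).
Proof.
rewrite /Cfun linear_sum lin_sumE; apply: eq_bigr => s _.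
rewrite linear_sum lin_sumE; apply: eq_bigr => t _.
by rewrite linearZ lin_scaleE free_dE.
Qed.

End ThetaCoordinates.

Unset Implicit Arguments.

Theorem proposition4 (R : realType) (A : hopfAlgType R[i])
    (r : universal_r_form A) (n : nat) (v : matrix_corep A n)
    (zeta : central_character A) :
  is_commutator_rep (Gamma_fodc r v zeta)
    (@lmul R[i] A : {lrmorphism A -> endo A}) (lact (Cfun r v zeta)).
Proof.
apply: (@left_linear_commutator_rep _ _ (Gamma_fodc r v zeta)
  (fun w => Acontract r v (Gamma_val w))) => [a w w'|a].
  exact: Acontract_linear.
exact: lact_Cfun.
Qed.
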